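(* Let $0<\alpha<1$. Then $\widetilde{W}^{\alpha,1}(\mathbb{R})\subseteq{}^{\pm}W^{\alpha,1}(\mathbb{R})$ (for each of the signs $-$ and $+$).
   Context: $\widetilde{W}^{\alpha,1}(\mathbb{R})$ is the Gagliardo-type fractional Sobolev space $\{u\in L^1(\mathbb{R}): \int_{\mathbb{R}}\int_{\mathbb{R}}\frac{|u(x)-u(y)|}{|x-y|^{1+\alpha}}dx\,dy<\infty\}$. For $0<\alpha<1$ and $\varphi\in C_0^\infty(\mathbb{R})$: ${}^{-}D^{\alpha}\varphi(x)=\frac{1}{\Gamma(1-\alpha)}\frac{d}{dx}\int_{-\infty}^x\frac{\varphi(y)}{(x-y)^{\alpha}}dy$ and ${}^{+}D^{\alpha}\varphi(x)=\frac{-1}{\Gamma(1-\alpha)}\frac{d}{dx}\int_x^{\infty}\frac{\varphi(y)}{(y-x)^{\alpha}}dy$. For $u\in L^1(\mathbb{R})$, $v\in L^1_{loc}(\mathbb{R})$ is the left (resp. right) weak fractional derivative of $u$, $v={}^{-}\mathcal{D}^{\alpha}u$ (resp. ${}^{+}\mathcal{D}^{\alpha}u$), if $\int_{\mathbb{R}} v\varphi\,dx=\int_{\mathbb{R}} u\,{}^{+}D^{\alpha}\varphi\,dx$ (resp. with ${}^{-}D^{\alpha}\varphi$) for all $\varphi\in C_0^\infty(\mathbb{R})$. ${}^{\pm}W^{\alpha,1}(\mathbb{R})=\{u\in L^1(\mathbb{R}): {}^{\pm}\mathcal{D}^{\alpha}u\in L^1(\mathbb{R})\}$. *)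

(* Defs.v *)
From HB Require Import structures.
From mathcomp Require Import all_boot all_order all_algebra.
From mathcomp Require Import all_classical all_reals all_analysis.

Set Implicit Arguments.
Unset Strict Implicit.
Unset Printing Implicit Defensive.

Import Order.TTheory GRing.Theory Num.Theory.
Import numFieldNormedType.Exports.

Local Open Scope classical_set_scope.
Local Open Scope ring_scope.

Definition Gamma (R : realType) (s : R) : R :=
  \int[@lebesgue_measure R]_(t in `]0, +oo[) (t `^ (s - 1) * expR (- t)).

(* The spaces below are sets of representatives: functions, not classes modulo
   a.e. equality.  Measurability is Borel measurability, for which the library
   states Lebesgue integration on R; every Lebesgue class has a Borel
   representative, and membership only depends on the class. *)
Definition L1 (R : realType) : set (R -> R) :=
  [set u | (@lebesgue_measure R).-integrable [set: R] (EFin \o u)].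

Definition test_function (R : realType) : set (R -> R) :=
  [set phi | (forall (n : nat) (x : R), derivable (derive1n n phi) x 1) /\
             compact (closure [set x | phi x != 0])].

Definition left_RL_derivative (R : realType) (alpha : R) (phi : R -> R) :
    R -> R :=
  fun x => (Gamma (1 - alpha))^-1 *
    (fun z => \int[@lebesgue_measure R]_(y in `]-oo, z[)
                (phi y / (z - y) `^ alpha))^`()%classic x.

Definition right_RL_derivative (R : realType) (alpha : R) (phi : R -> R) :
    R -> R :=
  fun x => - (Gamma (1 - alpha))^-1 *
    (fun z => \int[@lebesgue_measure R]_(y in `]z, +oo[)
                (phi y / (y - z) `^ alpha))^`()%classic x.

(* The left weak derivative is tested against right derivatives of test
   functions, and conversely. *)
Definition is_left_weak_derivative (R : realType) (alpha : R) (u v : R -> R) :=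
  [/\ L1 u, locally_integrable [set: R] v &
    forall phi : R -> R, test_function phi ->
      (\int[@lebesgue_measure R]_x (v x * phi x)%:E =
       \int[@lebesgue_measure R]_x (u x * right_RL_derivative alpha phi x)%:E)%E].

Definition is_right_weak_derivative (R : realType) (alpha : R) (u v : R -> R) :=
  [/\ L1 u, locally_integrable [set: R] v &
    forall phi : R -> R, test_function phi ->
      (\int[@lebesgue_measure R]_x (v x * phi x)%:E =
       \int[@lebesgue_measure R]_x (u x * left_RL_derivative alpha phi x)%:E)%E].

Definition left_W1 (R : realType) (alpha : R) : set (R -> R) :=
  [set u | L1 u /\ exists v, is_left_weak_derivative alpha u v /\ L1 v].

Definition right_W1 (R : realType) (alpha : R) : set (R -> R) :=
  [set u | L1 u /\ exists v, is_right_weak_derivative alpha u v /\ L1 v].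

(* On the diagonal x = y the integrand is 0 / 0 = 0. *)
Definition gagliardo_W1 (R : realType) (alpha : R) : set (R -> R) :=
  [set u | L1 u /\
    (\int[@lebesgue_measure R]_y \int[@lebesgue_measure R]_x
       (`|u x - u y| / `|x - y| `^ (1 + alpha))%:E < +oo)%E].

(* Main.v *)
(** Write k(t) = t^(-1-alpha) for t > 0 and k(t) = 0 otherwise, and let s = 1 or
    s = -1.  Since t^(-alpha) = alpha * \int_(r >= t) k(r) dr, differentiating
    the Riemann-Liouville integral of a test function phi under the integral
    sign and applying Fubini gives Marchaud's formula: up to the factor
    alpha / Gamma(1 - alpha), the derivative of phi at x is
    \int k(r) (phi(x) - phi(x + s r)) dr.  For u in the Gagliardo space the
    function (x, t) |-> k(t) (u(x) - u(x - s t)) is integrable on the plane, so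
    its integral over t is an L^1 function of x.  Fubini and the translation
    invariance of Lebesgue measure, at fixed t, move the difference operator
    from u to phi. *)
Require Import Defs.
From HB Require Import structures.
From mathcomp Require Import all_boot all_order all_algebra.
From mathcomp Require Import all_classical all_reals all_analysis.
From mathcomp Require Import measurable_realfun lra.

Set Implicit Arguments.
Unset Strict Implicit.
Unset Printing Implicit Defensive.

Import Order.TTheory GRing.Theory Num.Theory.
Import numFieldNormedType.Exports.

Local Open Scope classical_set_scope.
Local Open Scope ring_scope.

(** * Invariance of Lebesgue measure under translations and reflections *)

Section isometry.
Context {R : realType}.
Notation mu := (@lebesgue_measure R).
Variables (s z : R).
Hypothesis s1 : s = 1 \/ s = -1.

Let T (t : R) : measurableTypeR R := z + s * t.

Lemma measurable_affine : measurable_fun [set: R] T.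
Proof. by apply: measurable_funD => //; apply: measurable_funM. Qed.

Let preimage_affine_itv (a b : R) : mu (T @^-1` `]a, b]) = mu `]a, b].
Proof.
case: s1 => s_eq.
- rewrite (_ : T @^-1` _ = `]a - z, b - z]%classic); last first.
    apply/seteqP; split => x /=; rewrite /T s_eq !in_itv/= mul1r.
      by rewrite ltrBlDl lerBrDl.
    by rewrite ltrBlDl lerBrDl.
  rewrite !lebesgue_measure_itv/= !lte_fin ltrD2r; case: ifPn => // _.
  by rewrite -!EFinB; congr EFin; lra.
(* A reflection moves the closed end to the left; the length is unchanged. *)
- rewrite (_ : T @^-1` _ = `[z - b, z - a[%classic); last first.
    apply/seteqP; split => x /=; rewrite /T s_eq !in_itv/= mulN1r.
      by rewrite ltrBrDl -ltrBrDr lerBlDl -lerBlDr andbC.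
    by rewrite [a < _]ltrBrDl -ltrBrDr [_ <= b]lerBlDl -lerBlDr andbC.
  rewrite !lebesgue_measure_itv/= !lte_fin ltrD2l ltrN2; case: ifPn => // _.
  by rewrite -!EFinB; congr EFin; lra.
Qed.

(** Lebesgue measure is the only measure giving half-open intervals their length, so the preimages
    of such intervals decide. *)
Lemma lebesgue_measure_affine (A : set R) : measurable A ->
  pushforward mu T A = mu A.
Proof.
move=> mA; apply/esym/lebesgue_measure_unique => //=.
  exact: measurable_affine.
move=> mT _ [[a b] _ <-].
by rewrite /pushforward preimage_affine_itv.
Qed.

Lemma ge0_integral_affine (f : R -> \bar R) : measurable_fun [set: R] f ->
  (forall x, 0 <= f x)%E ->
  (\int[mu]_t f (z + s * t)%R = \int[mu]_x f x)%E.
Proof.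
move=> mf f0.
rewrite [RHS](eq_measure_integral (pushforward mu T)).
- exact: measurable_affine.
- by move=> mT; rewrite ge0_integral_pushforward.
- by move=> mT A mA _; apply/esym/lebesgue_measure_affine.
Qed.

Lemma integrable_affine (f : R -> \bar R) : mu.-integrable [set: R] f ->
  mu.-integrable [set: R] (fun t => f (z + s * t)).
Proof.
move=> /integrableP[mf foo]; apply/integrableP; split.
  exact: (measurableT_comp mf measurable_affine).
rewrite (ge0_integral_affine (f := fun x => `|f x|%E))//.
exact: measurableT_comp.
Qed.

Lemma integral_affine (f : R -> \bar R) : mu.-integrable [set: R] f ->
  (\int[mu]_t f (z + s * t)%R = \int[mu]_x f x)%E.
Proof.
move=> intf; have /integrableP[mf _] := intf.
rewrite [RHS](eq_measure_integral (pushforward mu T)).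
- exact: measurable_affine.
- by move=> mT; rewrite integral_pushforward//; exact: integrable_affine.
- by move=> mT A mA _; apply/esym/lebesgue_measure_affine.
Qed.

End isometry.

(** * Integrals of powers near infinity and near zero *)

Section power_integrals.
Context {R : realType}.
Notation mu := (@lebesgue_measure R).

Lemma continuous_powR_pos (p x : R) : 0 < x ->
  {for x, continuous (fun y => y `^ p)}.
Proof.
move=> x0; apply: differentiable_continuous; apply/derivable1_diffP.
by have [] := is_derive1_powR p x0.
Qed.

Lemma cvg_powRN_pinfty (a : R) : 0 < a -> x `^ (- a) @[x --> +oo] --> (0 : R).
Proof.
move=> a0; apply/cvgrPdist_lt => e e0; near=> x.
have x0 : 0 < x by near: x; exact: nbhs_pinfty_gt.
rewrite sub0r normrN ger0_norm ?powR_ge0// powRN.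
rewrite invf_plt ?posrE ?powR_gt0//.
(* With 1/e written as the a-th power of (1/e)^(1/a), it suffices to compare bases: x >
   (1/e)^(1/a). *)
rewrite -[e^-1]powRr1 ?invr_ge0 ?ltW// -(mulVf (lt0r_neq0 a0)) powRrM.
rewrite gt0_ltr_powR ?nnegrE ?powR_ge0 ?(ltW x0)//.
Unshelve. all: by end_near. Qed.

Lemma integral_powR_tail (a t : R) : 0 < a -> 0 < t ->
  (\int[mu]_(x in `[t, +oo[) (x `^ (- (1 + a)))%:E = (t `^ (- a) / a)%:E)%E.
Proof.
move=> a0 t0; have a_neq0 := lt0r_neq0 a0.
pose F (x : R) := - a^-1 * x `^ (- a).
have F' (x : R) : 0 < x -> is_derive x 1 F (x `^ (- (1 + a))).
  move=> x0; apply: is_derive_eq (is_deriveZ (- a^-1) 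
    (is_derive1_powR (- a) x0)) _.
  by rewrite /GRing.scale/= mulrA mulrNN mulVf// mul1r; congr powR; lra.
rewrite (@ge0_continuous_FTC2y _ _ F _ 0).
- by rewrite sub0e /F -EFinN mulNr opprK mulrC.
- by move=> x _; exact: powR_ge0.
- apply: continuous_in_subspaceT => x /set_mem/=; rewrite in_itv/= andbT => tx.
  exact: continuous_powR_pos (lt_le_trans t0 tx).
- rewrite -[X in _ --> X](mulr0 (- a^-1)); apply: cvgM; first exact: cvg_cst.
  exact: cvg_powRN_pinfty.
- by move=> x tx; have [] := F' x (lt_trans t0 tx).
- apply: cvg_at_right_filter; apply: cvgM; first exact: cvg_cst.
  exact: continuous_powR_pos.
- move=> x; rewrite in_itv/= andbT => tx.
  by have [_] := F' x (lt_trans t0 tx); rewrite derive1E.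
Qed.

(** The bound is uniform in e, which lets e tend to 0 afterwards. *)
Lemma integral_powR_origin_le (p e t : R) : 0 < p -> 0 < e -> e < t ->
  (\int[mu]_(x in `[e, t]) (x `^ (p - 1))%:E <= (t `^ p / p)%:E)%E.
Proof.
move=> p0 e0 et; have p_neq0 := lt0r_neq0 p0.
pose F (x : R) := p^-1 * x `^ p.
have F' (x : R) : 0 < x -> is_derive x 1 F (x `^ (p - 1)).
  move=> x0; apply: is_derive_eq (is_deriveZ p^-1 (is_derive1_powR p x0)) _.
  by rewrite /GRing.scale/= mulrA mulVf// mul1r.
have cF (x : R) : 0 < x -> {for x, continuous F}.
  by move=> x0; apply: cvgM; [exact: cvg_cst|exact: continuous_powR_pos].
rewrite (@continuous_FTC2 _ _ F)//.
- rewrite -EFinB lee_fin /F mulrC lerBlDr lerDl.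
  by rewrite mulr_ge0 ?powR_ge0 ?invr_ge0 ?ltW.
- apply: continuous_in_subspaceT => x /set_mem/=.
  rewrite in_itv/= => /andP[ex _].
  exact: continuous_powR_pos (lt_le_trans e0 ex).
- split.
  + move=> x; rewrite in_itv/= => /andP[ex _].
    by have [] := F' x (lt_trans e0 ex).
  + by apply: cvg_at_right_filter; exact: cF.
  + by apply: cvg_at_left_filter; apply: cF; exact: lt_trans et.
- move=> x; rewrite in_itv/= => /andP[ex _].
  by have [_] := F' x (lt_trans e0 ex); rewrite derive1E.
Qed.

Lemma integrable_powR_origin (p t : R) : 0 < p -> 0 < t ->
  mu.-integrable `]0, t] (fun x => (x `^ (p - 1))%:E).
Proof.
move=> p0 t0.
have mpow (D : set R) : measurable_fun D (fun x : R => (x `^ (p - 1))%:E).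
  apply/measurable_funTS/measurable_EFinP; exact: measurable_powR.
apply/integrableP; split; first exact: mpow.
under eq_integral do rewrite gee0_abs ?lee_fin ?powR_ge0//.
(* Monotone convergence along compact intervals exhausting []0, t]]; with [n.+2] the left end is
   below t already at n = 0, as [integral_powR_origin_le] requires. *)
pose F (n : nat) : set R := `[t / n.+2%:R, t]%classic.
have -> : `]0, t]%classic = \bigcup_n F n.
  apply/seteqP; split => [x|x [n _]] /=; rewrite /F/= !in_itv/=.
    move=> /andP[x0 xt]; have [n nP] := ltr_add_invr (divr_gt0 x0 t0).
    exists n => //=; rewrite in_itv/= xt andbT.
    rewrite add0r in nP; move: nP => /ltW nP.
    rewrite ler_pdivlMr// in nP; rewrite mulrC; apply: le_trans nP.
    by rewrite ler_pM2r// lef_pV2 ?posrE// ler_nat.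
  move=> /andP[tx xt]; rewrite xt andbT; apply: lt_le_trans tx.
  by rewrite divr_gt0.
apply: (@le_lt_trans _ _ (t `^ p / p)%:E); last exact: ltry.
have cvgF : (\int[mu]_(x in F i) (x `^ (p - 1))%:E @[i --> \oo] -->
  \int[mu]_(x in \bigcup_i F i) (x `^ (p - 1))%:E)%E.
  apply: ge0_nondecreasing_set_cvg_integral => //.
  - apply/nondecreasing_seqP => n; rewrite subsetEset => x/=.
    rewrite /F/= !in_itv/= => /andP[tx ->]; rewrite andbT; apply: le_trans tx.
    by rewrite ler_pM2l// lef_pV2 ?posrE// ler_nat.
  - by move=> i; exact: measurable_itv.
  - by move=> i; exact: mpow.
  - by move=> i x _; rewrite lee_fin powR_ge0.
rewrite -(cvg_lim _ cvgF)//; apply: lime_le; first by apply: cvgP cvgF.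
apply: nearW => n; apply: integral_powR_origin_le => //; first exact: divr_gt0.
by rewrite ltr_pdivrMr// ltr_pMr// ltr1n.
Qed.

End power_integrals.

(** * The Marchaud kernel and its integrability *)

Section kernel.
Context {R : realType}.
Notation mu := (@lebesgue_measure R).
Implicit Types (a t : R).

Lemma integrable_patch_itv (i : interval R) (f : R -> \bar R) :
  mu.-integrable [set` i] f -> mu.-integrable [set: R] (f \_ [set` i]).
Proof.
exact: (iffLR (@integrable_mkcond _ _ R mu [set` i] f (measurable_itv i))).
Qed.

(** Extension by 0 to t <= 0 lets the integrals run over the whole line, so that Fubini applies on
    the full plane. *)
Definition marchaud_kernel a t : R := if 0 < t then t `^ (- (1 + a)) else 0.

Lemma marchaud_kernel_ge0 a t : 0 <= marchaud_kernel a t.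
Proof. by rewrite /marchaud_kernel; case: ifPn => // _; exact: powR_ge0. Qed.

Lemma measurable_marchaud_kernel a :
  measurable_fun [set: R] (marchaud_kernel a).
Proof.
by apply: measurable_fun_ifT => //; exact: measurable_fun_ltr.
Qed.

(** The indicator form of the tail makes t and r independent variables, ready for Fubini. *)
Lemma integral_kernel_tail a t : 0 < a -> 0 < t ->
  (\int[mu]_r ((t <= r)%R%:R * marchaud_kernel a r)%:E = (t `^ (- a) / a)%:E)%E.
Proof.
move=> a0 t0; rewrite -integral_powR_tail// [RHS]integral_mkcond.
apply: eq_integral => r _; rewrite patchE mem_setE in_itv/= andbT.
case: ifPn => tr; rewrite /marchaud_kernel ?mul0r//.
by rewrite (lt_le_trans t0 tr) mul1r.
Qed.

(** [Num.min t 1] models the increments of a test function: linear near 0, bounded far away. The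
    product is t^(-a) on []0, 1]], integrable as a < 1, and t^(-1-a) beyond, integrable as a > 0. *)
Lemma integrable_kernel_min a : 0 < a -> a < 1 ->
  mu.-integrable [set: R] (fun t => (marchaud_kernel a t * Num.min t 1)%:E).
Proof.
move=> a0 a1.
have int0 : mu.-integrable [set: R]
    ((fun t => (t `^ (1 - a - 1))%:E) \_ `]0, 1]).
  apply: integrable_patch_itv; apply: integrable_powR_origin => //.
  by rewrite subr_gt0.
have int1 : mu.-integrable [set: R]
    ((fun t => (t `^ (- (1 + a)))%:E) \_ `[1, +oo[).
  apply: integrable_patch_itv; apply/integrableP; split.
    by apply/measurable_funTS/measurable_EFinP; exact: measurable_powR.
  under eq_integral do rewrite gee0_abs ?lee_fin ?powR_ge0//.
  by rewrite integral_powR_tail// ltry.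
apply: le_integrable (integrableD _ int0 int1) => //.
  apply/measurable_EFinP; apply: measurable_funM.
    exact: measurable_marchaud_kernel.
  exact: measurable_minr.
move=> t _; rewrite /marchaud_kernel /= !patchE !mem_setE !in_itv/= andbT.
case: ltP => t0 /=; last by rewrite mul0r normr0 abse_ge0.
have [t1|t1] := ltP t 1.
  rewrite (ltW t1)/= addr0 lee_fin.
  rewrite le_eqVlt; apply/orP; left; apply/eqP; congr `|_|.
  rewrite -[X in _ * X](powRr1 (ltW t0)) -powRD ?(gt_eqF t0) ?implybT//.
  by congr powR; lra.
rewrite mulr1.
(* At t = 1 both majorants contribute, which only enlarges the bound. *)
case: ifPn => _ /=; last by rewrite add0r lexx.
rewrite lee_fin !ger0_norm ?powR_ge0 ?addr_ge0 ?powR_ge0//.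
by rewrite lerDr powR_ge0.
Qed.

End kernel.

(** * Bounds for functions vanishing outside a bounded set *)

Section compact_support.
Context {R : realType}.
Implicit Types (f : R -> R) (M T : R).

Lemma bounded_of_compact_support f T : continuous f ->
  (forall x, T < `|x| -> f x = 0) -> exists M, forall x, `|f x| <= M.
Proof.
move=> cf f0.
have cpt : compact (f @` `[- T, T]).
  apply: continuous_compact; last exact: segment_compact.
  exact: continuous_subspaceT.
have [M [_ /(_ (M + 1))]] := compact_bounded cpt.
(* [compact_bounded] offers every bound above M, whence M + 1; the maximum with 0 covers the points
   where f vanishes. *)
rewrite ltrDl ltr01 => /(_ isT) fM; exists (Num.max (M + 1) 0) => x.
have [xT|Tx] := leP `|x| T; last by rewrite f0// normr0 le_max lexx orbT.
rewrite le_max (fM (f x))//; exists x => //=.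
by rewrite in_itv/= -ler_norml.
Qed.

Lemma lipschitz_of_derive1_bounded f M : (forall x, derivable f x 1) ->
  (forall x, `|f^`()%classic x| <= M) ->
  forall x y, `|f y - f x| <= M * `|y - x|.
Proof.
move=> df f'M x y; wlog xy : x y / x <= y.
  move=> h; have [/h//|/ltW/h] := leP x y.
  by rewrite distrC (distrC x).
have [||c _ ->] := @MVT_segment R f f^`()%classic x y xy.
- by move=> z _; rewrite derive1E; exact/derivableP.
- apply: continuous_subspaceT => z.
  by apply: differentiable_continuous; apply/derivable1_diffP.
- by rewrite normrM ler_wpM2r.
Qed.

(** The region T < |x| is open, so f vanishes in a neighbourhood of x. *)
Lemma derive1_vanishes_outside f T : (forall x, T < `|x| -> f x = 0) ->
  forall x, T < `|x| -> f^`()%classic x = 0.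
Proof.
move=> f0 x Tx; rewrite derive1E (@near_eq_derive _ _ _ f (cst 0)).
- exact: derive_cst.
- near=> y; apply: f0; near: y.
  by apply: (cvgr_gt `|x|) => //; exact: norm_continuous.
Unshelve. all: by end_near. Qed.

End compact_support.

(** * Regularity and support of test functions *)

Section test_functions.
Context {R : realType}.
Variable phi : R -> R.
Hypothesis tphi : test_function phi.

Lemma test_function_derivable x : derivable phi x 1.
Proof. by have [/(_ 0%N)] := tphi. Qed.

Lemma test_function_continuous : continuous phi.
Proof.
move=> x; apply: differentiable_continuous; apply/derivable1_diffP.
exact: test_function_derivable.
Qed.

Lemma test_function_derive1_continuous : continuous phi^`()%classic.
Proof.
move=> x; apply: differentiable_continuous; apply/derivable1_diffP.
by have [/(_ 1%N)] := tphi.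
Qed.

Lemma test_function_support : exists2 T, 0 <= T &
  forall x, T < `|x| -> phi x = 0.
Proof.
have [_ /compact_bounded[M [_ /(_ (M + 1))]]] := tphi.
rewrite ltrDl ltr01 => /(_ isT) suppM; exists (Num.max (M + 1) 0).
  by rewrite le_max lexx orbT.
move=> x; rewrite gt_max => /andP[Mx _]; apply/eqP/negPn/negP => phix.
have /= := suppM x (@subset_closure _ [set y | phi y != 0] x phix).
by rewrite leNgt Mx.
Qed.

End test_functions.

(** * Riemann-Liouville integrals and differentiation under the integral sign *)

Section fractional_integral.
Context {R : realType}.
Notation mu := (@lebesgue_measure R).
Variables a s : R.
Hypotheses (a1 : a < 1) (s1 : s = 1 \/ s = -1).

(** Integrable majorant for the Riemann-Liouville integrand: M bounds the function, and T the range
    of t for which its argument can meet the support. *)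
Definition cutoff_powR (M T t : R) : R :=
  if (0 < t) && (t <= T) then M * t `^ (- a) else 0.

Lemma integrable_cutoff_powR M T : 0 < T ->
  mu.-integrable [set: R] (EFin \o cutoff_powR M T).
Proof.
move=> T0.
have p0 : 0 < 1 - a by rewrite subr_gt0.
have := integrableZl measurableT M
  (integrable_patch_itv (integrable_powR_origin p0 T0)).
apply: eq_integrable => // t _.
rewrite /= patchE mem_setE in_itv/= /cutoff_powR.
case: ifPn => _; last by rewrite mule0.
by rewrite -EFinM addrAC subrr add0r.
Qed.

Lemma norm_div_powR_le_cutoff (f : R -> R) M T X x t :
  (forall y, `|f y| <= M) -> (forall y, T < `|y| -> f y = 0) ->
  `|x| <= X -> 0 < t ->
  `|f (x + s * t) / t `^ a| <= cutoff_powR M (X + T) t.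
Proof.
move=> fM f0 xX t0; rewrite /cutoff_powR t0/=; case: ifPn => [_|].
  by rewrite powRN normrM [`|_^-1|]ger0_norm ?invr_ge0 ?powR_ge0//
    ler_wpM2r// invr_ge0 powR_ge0.
(* Here t > X + T, so |x + s t| >= t - |x| > T and f vanishes. *)
rewrite -ltNge => tXT; rewrite f0 ?mul0r ?normr0//.
have : `|s * t| = t by case: s1 => ->; rewrite ?mul1r ?mulN1r ?normrN gtr0_norm.
by have := lerB_normD (s * t) x; rewrite (addrC x); lra.
Qed.

(* The Riemann-Liouville integral without its Gamma factor, after the
   substitution y = z + s t: right-sided for s = 1, left-sided for s = -1. *)
Definition frac_integral (phi : R -> R) (z : R) : R :=
  \int[mu]_(t in `]0, +oo[) (phi (z + s * t) / t `^ a).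

Lemma integrable_frac_integral (f : R -> R) M T z : continuous f ->
  (forall y, `|f y| <= M) -> (forall y, T < `|y| -> f y = 0) ->
  mu.-integrable `]0, +oo[ (fun t => (f (z + s * t) / t `^ a)%:E).
Proof.
move=> cf fM f0.
(* T may be negative here and [integrable_cutoff_powR] asks for a positive range, hence |T| + 1. *)
have int_cut : mu.-integrable `]0, +oo[%classic
    (EFin \o cutoff_powR M (`|z| + (`|T| + 1))).
  apply: (integrableS measurableT) => //.
  by apply: integrable_cutoff_powR; rewrite addrA ltr_wpDl.
apply: le_integrable int_cut => //.
  apply/measurable_EFinP/measurable_funTS/measurable_funM.
    apply: measurableT_comp; first exact: continuous_measurable_fun.
    exact: measurable_affine.
  rewrite (_ : (fun x => _) = (fun t => t `^ (- a))).
    exact: measurable_powR.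
  by apply/funext => t; rewrite powRN.
move=> t /=; rewrite in_itv/= andbT => t0; rewrite lee_fin.
apply: le_trans (ler_norm _); apply: norm_div_powR_le_cutoff => //.
by move=> y Ty; apply: f0; apply: le_lt_trans Ty; rewrite ler_wpDr// ler_norm.
Qed.

Variable phi : R -> R.
Hypothesis tphi : test_function phi.

(** Dominated differentiation: after the substitution z occurs only in the argument of phi, so the
    singular weight is never differentiated. *)
Lemma derive1_frac_integral z :
  (frac_integral phi)^`()%classic z = frac_integral (phi^`()%classic) z.
Proof.
have [T T0 phi0] := test_function_support tphi.
have dphi0 := derive1_vanishes_outside phi0.
have cphi := test_function_continuous tphi.
have cdphi := test_function_derive1_continuous tphi.
have [M phiM] := bounded_of_compact_support cphi phi0.
have [N dphiN] := bounded_of_compact_support cdphi dphi0.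
have N0 : 0 <= N by exact: le_trans (dphiN 0).
have dshift (t y : R) :
  is_derive y (1 : R) (fun x : R => phi (x + s * t) / t `^ a)
    (phi^`()%classic (y + s * t) / t `^ a).
  have dphi : is_derive (y + s * t) 1 phi (phi^`()%classic (y + s * t)).
    by rewrite derive1E; apply/derivableP; exact: test_function_derivable.
  have dD : is_derive y 1 (fun x : R => x + s * t) 1.
    have := is_deriveD (is_derive_id y 1) (is_derive_cst (s * t) y 1).
    by move=> /is_derive_eq; apply; rewrite addr0.
  have dcomp := is_deriveZ (t `^ a)^-1
    (@is_derive1_comp R phi (fun x => x + s * t) y _ _ dphi dD).
  rewrite [X in is_derive _ _ X _](_ : _ =
      (t `^ a)^-1 \*: (phi \o (fun x => x + s * t))).
    by apply: is_derive_eq dcomp _; rewrite mulr1 /GRing.scale/= mulrC.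
  by apply/funext => x; rewrite /= mulrC.
rewrite /frac_integral.
transitivity (\int[mu]_(t in `]0, +oo[)
    partial1of2 (fun x t => phi (x + s * t) / t `^ a) z t); last first.
  apply: eq_Rintegral => t _; rewrite /partial1of2 derive1E.
  by have [_ ->] := dshift t z.
(* For x within 1 of z, |x| <= |z| + 1, so a single cutoff dominates the partial derivatives on that
   interval. *)
apply: (@differentiation_under_integral _ _ _ mu
   (fun x t => phi (x + s * t) / t `^ a) _ _ z (z - 1) (z + 1)
   _ _ _ (cutoff_powR N (`|z| + 1 + (T + 1)))) => //=.
- by rewrite in_itv/= ltrBlDr !ltrDl ltr01.
- by move=> x _; exact: integrable_frac_integral cphi phiM phi0.
- move=> t; rewrite /cutoff_powR; case: ifPn => // _.
  by rewrite mulr_ge0// powR_ge0.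
- apply: (integrableS measurableT) => //.
  by apply: integrable_cutoff_powR; rewrite addr_gt0 ?ltr_wpDl.
- move=> x t; rewrite !in_itv/= andbT => /andP[zx xz] t0.
  rewrite /partial1of2 derive1E; have [_ ->] := dshift t x.
  apply: norm_div_powR_le_cutoff => //.
    by move=> y Ty; apply: dphi0; lra.
  have : `|x - z| <= 1 by rewrite ler_norml; lra.
  by have := ler_normD z (x - z); rewrite addrCA subrr addr0; lra.
Qed.

End fractional_integral.

(** * Marchaud's formula for test functions *)

Section marchaud_representation.
Context {R : realType}.
Notation mu := (@lebesgue_measure R).
Variables a s : R.
Hypotheses (a0 : 0 < a) (a1 : a < 1) (s1 : s = 1 \/ s = -1).
Variable phi : R -> R.
Hypothesis tphi : test_function phi.

(** The antiderivative is s phi(z + s t): its factor s cancels the inner derivative because s^2 =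
    1. *)
Lemma integral_derive1_shift (z r : R) : 0 < r ->
  (\int[mu]_(t in `[0%R, r]) (phi^`()%classic (z + s * t))%:E =
   (s * (phi (z + s * r) - phi z))%:E)%E.
Proof.
move=> r0; have ss : s * s = 1 by case: s1 => ->; lra.
have cdphi := test_function_derive1_continuous tphi.
have cshift : continuous (fun t : R => z + s * t).
  move=> t; apply: cvgD; first exact: cvg_cst.
  by apply: cvgM; [exact: cvg_cst|exact: cvg_id].
pose F t := s * phi (z + s * t).
have dF (t : R) : is_derive t (1 : R) F (phi^`()%classic (z + s * t)).
  have dphi : is_derive (z + s * t) 1 phi (phi^`()%classic (z + s * t)).
    by rewrite derive1E; apply/derivableP; exact: test_function_derivable.
  have dD : is_derive t (1 : R) (fun t : R => z + s * t) s.
    have := is_deriveD (is_derive_cst z t 1) (is_deriveZ s (is_derive_id t 1)).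
    by move=> /is_derive_eq; apply; rewrite add0r /GRing.scale/= mulr1.
  have dcomp := is_deriveZ s
    (@is_derive1_comp R phi (fun t => z + s * t) t _ _ dphi dD).
  by apply: is_derive_eq dcomp _; rewrite /GRing.scale/= mulrCA ss mulr1.
have cF t : {for t, continuous F}.
  by apply: differentiable_continuous; apply/derivable1_diffP; have [] := dF t.
rewrite (@continuous_FTC2 _ _ F)//.
- by rewrite -EFinB /F mulr0 addr0 mulrBr.
- apply: continuous_subspaceT => t.
  by apply: continuous_comp; [exact: cshift|exact: cdphi].
- split.
  + by move=> t _; have [] := dF t.
  + by apply: cvg_at_right_filter; exact: cF.
  + by apply: cvg_at_left_filter; exact: cF.
- by move=> t _; rewrite derive1E; have [_ ->] := dF t.
Qed.

Lemma integrable_kernel_tail t : 0 < t ->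
  mu.-integrable [set: R] (fun r => ((t <= r)%R%:R * marchaud_kernel a r)%:E).
Proof.
move=> t0; apply/integrableP; split.
  apply/measurable_EFinP/measurable_funM.
    by apply: measurableT_comp => //; exact: measurable_fun_ler.
  exact: measurable_marchaud_kernel.
under eq_integral do rewrite gee0_abs ?lee_fin
  ?mulr_ge0 ?ler0n ?marchaud_kernel_ge0//.
by rewrite integral_kernel_tail// ltry.
Qed.

(** Once t^(-a) is written as a times a kernel tail and the integrals are exchanged, the integral
    over t collapses to an increment of phi. *)
Lemma frac_integral_derive1E z :
  ((frac_integral a s (phi^`()%classic) z)%:E =
   \int[mu]_r (a * s * (marchaud_kernel a r * (phi (z + s * r) - phi z)))%:E)%E.
Proof.
have [T T0 phi0] := test_function_support tphi.
have dphi0 := derive1_vanishes_outside phi0.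
have cdphi := test_function_derive1_continuous tphi.
have [N dphiN] := bounded_of_compact_support cdphi dphi0.
have a_neq0 := lt0r_neq0 a0.
have intf := integrable_frac_integral a1 s1 z cdphi dphiN dphi0.
pose psi t := if 0 < t then phi^`()%classic (z + s * t) else 0.
have mpsi : measurable_fun [set: R] psi.
  apply: measurable_fun_ifT => //; first exact: measurable_fun_ltr.
  apply: measurableT_comp; first exact: continuous_measurable_fun.
  exact: measurable_affine.
have patchE_psi :
    ((fun t => (phi^`()%classic (z + s * t) / t `^ a)%:E) \_ `]0, +oo[) =
    (fun t => (psi t * t `^ (- a))%:E).
  apply/funext => t; rewrite patchE mem_setE in_itv/= andbT /psi.
  by case: ifPn => _; [rewrite powRN|rewrite mul0r].
have intpsi : mu.-integrable [set: R] (fun t => (psi t * t `^ (- a))%:E).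
  by rewrite -patchE_psi; exact: integrable_patch_itv.
pose h (p : R * R) :=
  (a * psi p.1 * ((p.1 <= p.2)%R%:R * marchaud_kernel a p.2))%:E.
have mh : measurable_fun [set: R * R] h.
  apply/measurable_EFinP/measurable_funM.
    by apply: measurable_funM => //; exact: measurableT_comp.
  apply: measurable_funM; last first.
    by apply: measurableT_comp => //; exact: measurable_marchaud_kernel.
  by apply: measurableT_comp => //; exact: measurable_fun_ler.
(* The free constant serves twice: c = a for [h], and c = sg(psi t) a for its absolute value. *)
have inner c t :
    (\int[mu]_r ((c * psi t) * ((t <= r)%R%:R * marchaud_kernel a r))%:E =
    (c * psi t * t `^ (- a) / a)%:E)%E.
  rewrite /psi; case: ifPn => t0; last first.
    by under eq_integral do rewrite mulr0 mul0r; rewrite integral0 mulr0 !mul0r.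
  under eq_integral do rewrite EFinM.
  rewrite integralZl//; last exact: integrable_kernel_tail.
  by rewrite integral_kernel_tail// -EFinM !mulrA.
(* Integrating |h| over r gives back |psi(t)| t^(-a), whose integrability is [intpsi]. *)
have inth : (mu \x mu)%E.-integrable [set: R * R] h.
  apply/integrable12ltyP => //.
  have -> : (\int[mu]_t \int[mu]_r `|h (t, r)| =
      \int[mu]_t `|(psi t * t `^ (- a))%:E|)%E.
    apply: eq_integral => t _.
    transitivity (\int[mu]_r ((Num.sg (psi t) * a * psi t) *
        ((t <= r)%R%:R * marchaud_kernel a r))%:E)%E.
      apply: eq_integral => r _; rewrite /h /= !normrM (gtr0_norm a0).
      rewrite (ger0_norm (ler0n _ _)) (ger0_norm (marchaud_kernel_ge0 _ _)).
      by congr (_ * _)%:E; rewrite (normrEsg (psi t)) mulrCA mulrA.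
    rewrite inner mulrAC [_ * a * _]mulrAC mulfK// -normrEsg /= normrM.
    by rewrite (ger0_norm (powR_ge0 _ _)).
  by have /integrableP[] := intpsi.
rewrite /frac_integral /Rintegral fineK; last exact: integrable_fin_num.
rewrite integral_mkcond patchE_psi.
transitivity (\int[mu]_t \int[mu]_r h (t, r))%E.
  by apply: eq_integral => t _; rewrite /h inner mulrAC [_ * psi t]mulrC mulfK.
rewrite Fubini//.
apply: eq_integral => r _; rewrite /h /=.
have [r0|r0] := ltP 0 r; last first.
  rewrite /marchaud_kernel ltNge r0/= mul0r mulr0.
  by under eq_integral do rewrite !mulr0; rewrite integral0.
(* The conditions 0 < t from [psi] and t <= r from the tail leave []0, r]]. *)
transitivity (\int[mu]_t ((a * marchaud_kernel a r)%:E *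
    ((fun t => (phi^`()%classic (z + s * t))%:E) \_ `]0%R, r]) t))%E.
  apply: eq_integral => t _.
  rewrite patchE mem_setE in_itv/= /psi; case: ltP => t0 /=.
    case: leP => tr; rewrite ?mul1r ?mul0r ?mulr0 ?mule0// -EFinM.
    by rewrite mulrAC.
  by rewrite mulr0 mul0r mule0.
rewrite integralZl//; last first.
  apply: integrable_patch_itv.
  apply: (@integrableS _ _ _ mu `[0, r]%classic) => //.
    by apply: subset_itvr; rewrite bnd_simp.
  apply: continuous_compact_integrable; first exact: segment_compact.
  apply: continuous_subspaceT => t.
  apply: continuous_comp; last exact: cdphi.
  apply: cvgD; first exact: cvg_cst.
  by apply: cvgM; [exact: cvg_cst|exact: cvg_id].
rewrite -integral_mkcond integral_itv_obnd_cbnd.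
  by rewrite integral_derive1_shift// -EFinM; congr EFin; rewrite mulrACA.
apply/measurable_EFinP/measurable_funTS.
apply: measurableT_comp; first exact: continuous_measurable_fun.
exact: measurable_affine.
Qed.

(** Marchaud's fractional derivative without its constant a / Gamma(1 - a). *)
Definition marchaud_derivative (phi : R -> R) (x : R) : R :=
  \int[mu]_r (marchaud_kernel a r * (phi x - phi (x + s * r))).

Lemma marchaud_integrand_bound : exists C, forall x r,
  `|marchaud_kernel a r * (phi x - phi (x + s * r))| <=
    C * (marchaud_kernel a r * Num.min r 1).
Proof.
have [T T0 phi0] := test_function_support tphi.
have dphi0 := derive1_vanishes_outside phi0.
have cphi := test_function_continuous tphi.
have cdphi := test_function_derive1_continuous tphi.
have [M phiM] := bounded_of_compact_support cphi phi0.
have [N dphiN] := bounded_of_compact_support cdphi dphi0.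
have M0 : 0 <= M by exact: le_trans (phiM 0).
have N0 : 0 <= N by exact: le_trans (dphiN 0).
(* N is a Lipschitz constant, used for r < 1; M + M bounds any increment, used for r >= 1. *)
exists (N + (M + M)) => x r.
have [r0|r0] := ltP 0 r; last first.
  by rewrite /marchaud_kernel ltNge r0/= !mul0r mulr0 normr0.
rewrite normrM (ger0_norm (marchaud_kernel_ge0 _ _)) mulrCA.
apply: ler_wpM2l; first exact: marchaud_kernel_ge0.
have [r1|r1] := ltP r 1; last first.
  rewrite mulr1; have := ler_normB (phi x) (phi (x + s * r)).
  by have := phiM x; have := phiM (x + s * r); lra.
rewrite distrC.
have := lipschitz_of_derive1_bounded (test_function_derivable tphi) dphiN x
  (x + s * r).
rewrite addrAC subrr add0r => /le_trans; apply.
have -> : `|s * r| = r.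
  by case: s1 => ->; rewrite ?mul1r ?mulN1r ?normrN gtr0_norm.
by rewrite ler_wpM2r ?(ltW r0)// lerDl addr_ge0.
Qed.

Lemma measurable_marchaud_integrand x : measurable_fun [set: R]
  (fun r => marchaud_kernel a r * (phi x - phi (x + s * r))).
Proof.
apply: measurable_funM; first exact: measurable_marchaud_kernel.
apply: measurable_funB => //.
apply: measurableT_comp; last exact: measurable_affine.
apply: continuous_measurable_fun; exact: test_function_continuous.
Qed.

Lemma integrable_marchaud_integrand x : mu.-integrable [set: R]
  (fun r => (marchaud_kernel a r * (phi x - phi (x + s * r)))%:E).
Proof.
have [C HC] := marchaud_integrand_bound.
apply: le_integrable
  (integrableZl measurableT C (integrable_kernel_min a0 a1)) => //.
  by apply/measurable_EFinP; exact: measurable_marchaud_integrand.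
move=> r _; rewrite /= lee_fin; apply: le_trans (HC x r) _.
exact: ler_norm.
Qed.

Lemma derive1_frac_integralE z :
  (frac_integral a s phi)^`()%classic z = - (a * s) * marchaud_derivative phi z.
Proof.
rewrite derive1_frac_integral//; apply: EFin_inj.
rewrite frac_integral_derive1E.
rewrite EFinM /marchaud_derivative /Rintegral fineK; last first.
  exact: integrable_fin_num (integrable_marchaud_integrand z).
rewrite -integralZl//; last exact: integrable_marchaud_integrand.
by apply: eq_integral => r _; rewrite -EFinM; congr EFin; lra.
Qed.

(** Substitution t = s (y - z), an isometry of the line; the domain is []z, +oo[] for s = 1 and
    []-oo, z[] for s = -1. *)
Lemma frac_integral_halfline z :
  \int[mu]_(y in [set y | 0 < s * (y - z)]) (phi y / (s * (y - z)) `^ a) =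
  frac_integral a s phi z.
Proof.
have [T T0 phi0] := test_function_support tphi.
have cphi := test_function_continuous tphi.
have [M phiM] := bounded_of_compact_support cphi phi0.
have ss : s * s = 1 by case: s1 => ->; lra.
have intf := integrable_patch_itv
  (integrable_frac_integral a1 s1 z cphi phiM phi0).
rewrite /frac_integral /Rintegral; congr fine.
rewrite [RHS]integral_mkcond -(integral_affine (- (s * z)) s1 intf).
rewrite integral_mkcond.
apply: eq_integral => y _.
rewrite !patchE.
have -> : (y \in [set y | 0 < s * (y - z)]) = (0 < s * (y - z)).
  by apply/idP/idP => [/set_mem|/mem_set].
rewrite mem_setE in_itv/= andbT.
have -> : - (s * z) + s * y = s * (y - z) by lra.
case: ifPn => // _; congr (phi _ / _)%:E.
by rewrite mulrA ss; lra.
Qed.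

End marchaud_representation.

(** * Moving the Marchaud difference from a Gagliardo function to a test function *)

Section marchaud_weak_derivative.
Context {R : realType}.
Notation mu := (@lebesgue_measure R).
Variables a s : R.
Hypotheses (a0 : 0 < a) (a1 : a < 1) (s1 : s = 1 \/ s = -1).
Variable u : R -> R.
Hypothesis gu : gagliardo_W1 a u.

Let measurable_u : measurable_fun [set: R] u.
Proof. by have [/integrableP[/measurable_EFinP]] := gu. Qed.

Let measurable_shift : measurable_fun [set: R * R] (fun p => u (p.1 - s * p.2)).
Proof.
apply: measurableT_comp => //; apply: measurable_funB => //.
exact: measurable_funM.
Qed.

Let measurable_diff : measurable_fun [set: R * R]
  (fun p => u p.1 - u (p.1 - s * p.2)).
Proof.
by apply: measurable_funB; [exact: measurableT_comp|exact: measurable_shift].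
Qed.

(** Substituting x = y - s t in the inner Gagliardo integral gives the integrand |u(y) - u(y - s t)|
    / |t|^(1 + a), and the kernel is at most |t|^(-1-a). *)
Lemma integrable_marchaud_difference : (mu \x mu)%E.-integrable [set: R * R]
  (fun p => (marchaud_kernel a p.2 * (u p.1 - u (p.1 - s * p.2)))%:E).
Proof.
have ns1 : - s = 1 \/ - s = -1.
  by case: s1 => ->; [right|left; rewrite opprK].
have [_ gagu] := gu.
pose V (p : R * R) := (`|u p.1 - u (p.1 - s * p.2)| / `|p.2| `^ (1 + a))%:E.
have mV : measurable_fun [set: R * R] V.
  apply/measurable_EFinP/measurable_funM.
    by apply: measurableT_comp => //; exact: measurable_diff.
  rewrite (_ : (fun x => _) = (fun p : R * R => `|p.2| `^ (- (1 + a)))).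
    apply: (@measurableT_comp _ _ _ _ _ _
      (fun t : R => `|t| `^ (- (1 + a)))) => //.
    apply: (@measurableT_comp _ _ _ _ _ _ (@powR R ^~ (- (1 + a)))) => //.
  by apply/funext => p; rewrite powRN.
have intV : (mu \x mu)%E.-integrable [set: R * R] V.
  apply/integrable12ltyP => //.
  rewrite (_ : (\int[mu]_y \int[mu]_t `|V (y, t)| =
      \int[mu]_y \int[mu]_x (`|u x - u y| / `|x - y| `^ (1 + a))%:E)%E) //.
  apply: eq_integral => y _.
  pose f (x : R) := (`|u x - u y| / `|x - y| `^ (1 + a))%:E.
  have mf : measurable_fun [set: R] f.
    apply/measurable_EFinP/measurable_funM.
      by apply: measurableT_comp => //; exact: measurable_funB.
    rewrite (_ : (fun x => _) = (fun x : R => `|x - y| `^ (- (1 + a)))).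
      apply: (@measurableT_comp _ _ _ _ _ _ (@powR R ^~ (- (1 + a)))) => //.
      by apply: measurableT_comp => //; exact: measurable_funB.
    by apply/funext => x; rewrite powRN.
  have f0 x : (0 <= f x)%E.
    by rewrite /f lee_fin mulr_ge0// invr_ge0 powR_ge0.
  rewrite -(ge0_integral_affine y ns1 mf f0).
  apply: eq_integral => t _; rewrite /V /f /=.
  rewrite ger0_norm ?mulr_ge0 ?invr_ge0 ?powR_ge0// mulNr.
  rewrite distrC addrAC subrr add0r normrN.
  congr (_ / _ `^ _)%:E.
  by case: s1 => ->; rewrite ?mul1r ?mulN1r ?normrN.
apply: le_integrable intV => //.
  apply/measurable_EFinP/measurable_funM; last exact: measurable_diff.
  by apply: measurableT_comp => //; exact: measurable_marchaud_kernel.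
move=> [x t] _; rewrite /V /= lee_fin.
rewrite normrM normrM normr_id mulrC ler_wpM2l//.
rewrite (ger0_norm (marchaud_kernel_ge0 _ _)) ger0_norm ?invr_ge0 ?powR_ge0//.
rewrite /marchaud_kernel; case: ifPn => t0; last by rewrite invr_ge0 powR_ge0.
by rewrite powRN gtr0_norm.
Qed.

(** Up to a constant, the candidate weak derivative. The shift x - s t is opposite to the one in
    [marchaud_derivative], as befits a formal adjoint. *)
Definition marchaud_difference (x : R) : R :=
  \int[mu]_t (marchaud_kernel a t * (u x - u (x - s * t))).

Lemma integrable_marchaud_difference_integral :
  mu.-integrable [set: R] (EFin \o marchaud_difference).
Proof.
have intF := integrable_fubini_F integrable_marchaud_difference.
apply: le_integrable intF => //.
  apply/measurable_EFinP; apply: measurableT_comp => //.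
  exact: measurable_fubini_F integrable_marchaud_difference.
(* Where the inner integral is infinite [fine] returns 0, so the domination by the Fubini function
   persists. *)
move=> x _; rewrite /marchaud_difference /Rintegral /fubini_F /=.
by case: (\int[mu]_t _)%E => [r| |] /=; rewrite ?normr0 ?leey.
Qed.

Variable phi : R -> R.
Hypothesis tphi : test_function phi.

Let measurable_phi : measurable_fun [set: R] phi.
Proof.
by apply: continuous_measurable_fun; exact: test_function_continuous.
Qed.

Let phi_bounded : exists M, forall x, `|phi x| <= M.
Proof.
have [T T0 phi0] := test_function_support tphi.
exact: bounded_of_compact_support (test_function_continuous tphi) phi0.
Qed.

Let integrable_mul_bounded (f g : R -> R) (M : R) :
  mu.-integrable [set: R] (EFin \o f) -> measurable_fun [set: R] g ->
  (forall x, `|g x| <= M) -> mu.-integrable [set: R] (fun x => (f x * g x)%:E).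
Proof.
move=> intf mg gM.
apply: le_integrable (integrableZl measurableT M intf) => //.
  apply/measurable_EFinP/measurable_funM => //.
  by have /integrableP[/measurable_EFinP] := intf.
move=> x _; rewrite /= lee_fin normrM normrM mulrC; apply: ler_wpM2r => //.
by apply: le_trans (gM x) _; exact: ler_norm.
Qed.

(** [W] and [Z] carry the difference on u and on phi respectively; their double integrals are to be
    compared. *)
Let W (p : R * R) : \bar R :=
  (marchaud_kernel a p.2 * (u p.1 - u (p.1 - s * p.2)) * phi p.1)%:E.

Let Z (p : R * R) : \bar R :=
  (u p.1 * (marchaud_kernel a p.2 * (phi p.1 - phi (p.1 + s * p.2))))%:E.

Let measurable_W : measurable_fun [set: R * R] W.
Proof.
apply/measurable_EFinP/measurable_funM; last exact: measurableT_comp.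
apply: measurable_funM; last exact: measurable_diff.
by apply: measurableT_comp => //; exact: measurable_marchaud_kernel.
Qed.

Let integrable_W : (mu \x mu)%E.-integrable [set: R * R] W.
Proof.
have [M phiM] := phi_bounded.
apply: le_integrable
  (integrableZl measurableT M integrable_marchaud_difference) => //.
move=> [x t] _; rewrite /W /= lee_fin mulrC !(normrM _ (_ * _)) normrM.
apply: ler_wpM2r => //.
by apply: le_trans (phiM x) _; exact: ler_norm.
Qed.

Let measurable_Z : measurable_fun [set: R * R] Z.
Proof.
apply/measurable_EFinP/measurable_funM; first exact: measurableT_comp.
apply: measurable_funM.
  by apply: measurableT_comp => //; exact: measurable_marchaud_kernel.
apply: measurable_funB; first exact: measurableT_comp.
apply: measurableT_comp => //; apply: measurable_funD => //.
exact: measurable_funM.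
Qed.

(** The increment bound is uniform in x, so |u(x)| times a fixed integrable function of t
    dominates. *)
Let integrable_Z : (mu \x mu)%E.-integrable [set: R * R] Z.
Proof.
have [C HC] := marchaud_integrand_bound a s1 tphi.
have [intu _] := gu.
pose g t := C * (marchaud_kernel a t * Num.min t 1).
have intg : mu.-integrable [set: R] (EFin \o g).
  exact: (integrableZl measurableT C (integrable_kernel_min a0 a1)).
have g0 t : 0 <= g t by exact: le_trans (HC 0 t).
have mg : measurable_fun [set: R] g.
  by have /integrableP[/measurable_EFinP] := intg.
pose Y (p : R * R) := (u p.1 * g p.2)%:E.
have intY : (mu \x mu)%E.-integrable [set: R * R] Y.
  apply/integrable12ltyP.
    by apply/measurable_EFinP/measurable_funM; exact: measurableT_comp.
  have gfin : (\int[mu]_t (g t)%:E)%E \is a fin_num.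
    by exact: integrable_fin_num.
  have -> : (\int[mu]_x \int[mu]_t `|Y (x, t)| =
      \int[mu]_x ((fine (\int[mu]_t (g t)%:E))%:E * `|(u x)%:E|))%E.
    apply: eq_integral => x _; rewrite fineK// muleC -integralZl//.
    by apply: eq_integral => t _; rewrite /Y /= normrM (ger0_norm (g0 t)) EFinM.
  rewrite ge0_integralZl_EFin//.
  - apply: lte_mul_pinfty => //.
      by rewrite lee_fin fine_ge0// integral_ge0// => t _; rewrite lee_fin.
    by have /integrableP[] := intu.
  - by apply: measurableT_comp => //; exact/measurable_EFinP.
  - by rewrite fine_ge0// integral_ge0// => t _; rewrite lee_fin.
apply: le_integrable intY => //.
move=> [x t] _; rewrite /Z /Y /= lee_fin normrM [leRHS]normrM ler_wpM2l//.
by rewrite (ger0_norm (g0 t)).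
Qed.

(** Valid at every x, since the increments of phi tame the kernel pointwise; for [W] the analogue is
    obtained almost everywhere. *)
Let fubini_F_Z x : fubini_F mu Z x = (u x * marchaud_derivative a s phi x)%:E.
Proof.
rewrite /fubini_F /Z /=; under eq_integral do rewrite EFinM.
have intx := integrable_marchaud_integrand a0 a1 s1 tphi x.
rewrite integralZl// EFinM /marchaud_derivative /Rintegral fineK//.
exact: integrable_fin_num.
Qed.

(** The difference is split only once t is fixed and the kernel is a constant: k is not integrable
    near 0, so the two halves need not be integrable on the plane. *)
Let integral_marchaud_difference :
  (\int[mu]_x (marchaud_difference x * phi x)%:E =
   \int[mu]_x (u x * marchaud_derivative a s phi x)%:E)%E.
Proof.
have [intu _] := gu.
have [M phiM] := phi_bounded.
have ns1 : - s = 1 \/ - s = -1.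
  by case: s1 => ->; [right|left; rewrite opprK].
transitivity (\int[mu]_x \int[mu]_t W (x, t))%E.
  apply: ae_eq_integral => //.
  - apply/measurable_EFinP/measurable_funM => //.
    by have /integrableP[/measurable_EFinP] :=
      integrable_marchaud_difference_integral.
  - exact: measurable_fubini_F integrable_W.
  (* For almost every x the section in t is integrable, and there [fine] loses nothing. *)
  - have := ae_integrable1 integrable_marchaud_difference.
    apply: filterS => x intx _; rewrite /W /=.
    under [RHS]eq_integral do rewrite EFinM.
    rewrite integralZr// EFinM /marchaud_difference /Rintegral fineK//.
    exact: integrable_fin_num.
rewrite (Fubini integrable_W).
transitivity (\int[mu]_t \int[mu]_x Z (x, t))%E; last first.
  rewrite -(Fubini integrable_Z).
  by apply: eq_integral => x _; exact: fubini_F_Z.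
apply: eq_integral => t _; rewrite /W /Z /=.
have intuphi := integrable_mul_bounded intu measurable_phi phiM.
have shiftE (x : R) : x - s * t = - (s * t) + 1 * x by rewrite mul1r addrC.
have intshift : mu.-integrable [set: R] (fun x => (u (x - s * t) * phi x)%:E).
  apply: (integrable_mul_bounded (f := fun x => u (x - s * t)) _
    measurable_phi phiM).
  have := integrable_affine (- (s * t)) (or_introl erefl) intu.
  by apply: eq_integrable => // x _; rewrite /= shiftE.
have mshift : measurable_fun [set: R] (fun x => phi (x + s * t)).
  by apply: measurableT_comp => //; exact: measurable_funD.
have intphi : mu.-integrable [set: R] (fun x => (u x * phi (x + s * t))%:E).
  exact: (integrable_mul_bounded intu mshift (fun x => phiM (x + s * t))).
transitivity ((marchaud_kernel a t)%:E *
   (\int[mu]_x (u x * phi x)%:E - \int[mu]_x (u (x - s * t) * phi x)%:E))%E.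
  rewrite -integralB// -integralZl//; last exact: integrableB.
  by apply: eq_integral => x _; rewrite -EFinB -EFinM -mulrA mulrBl.
have -> : (\int[mu]_x (u (x - s * t) * phi x)%:E =
    \int[mu]_x (u x * phi (x + s * t))%:E)%E.
  (* A translation by s t: the isometry sign is 1 whatever s is. *)
  rewrite -(integral_affine (- (s * t)) (or_introl erefl) intphi).
  by apply: eq_integral => x _; rewrite mul1r [- _ + _]addrC subrK.
rewrite -integralB// -integralZl//; last exact: integrableB.
by apply: eq_integral => x _; rewrite -EFinB -EFinM -mulrBr mulrCA.
Qed.

Lemma integral_marchaud_differenceZ c :
  (\int[mu]_x (c * marchaud_difference x * phi x)%:E =
   \int[mu]_x (u x * (c * marchaud_derivative a s phi x))%:E)%E.
Proof.
have [M phiM] := phi_bounded.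
transitivity (c%:E * \int[mu]_x (marchaud_difference x * phi x)%:E)%E.
  rewrite -integralZl//.
    by apply: eq_integral => x _; rewrite -EFinM mulrA.
  exact: integrable_mul_bounded integrable_marchaud_difference_integral
    measurable_phi phiM.
rewrite integral_marchaud_difference -integralZl//.
  by apply: eq_integral => x _; rewrite -EFinM mulrCA.
apply: eq_integrable (integrable_fubini_F integrable_Z) => // x _.
exact: fubini_F_Z.
Qed.

End marchaud_weak_derivative.

(** * The left and right Riemann-Liouville derivatives, and the inclusions *)

Section Riemann_Liouville.
Context {R : realType}.
Notation mu := (@lebesgue_measure R).
Variable a : R.
Hypotheses (a0 : 0 < a) (a1 : a < 1).

(** The minus sign of the definition cancels the one in the factor - a s = - a of
    [derive1_frac_integralE]. *)
Lemma right_RL_derivativeE (phi : R -> R) x : test_function phi ->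
  right_RL_derivative a phi x =
  (Gamma (1 - a))^-1 * a * marchaud_derivative a 1 phi x.
Proof.
move=> tphi; have s1 : (1 : R) = 1 \/ (1 : R) = -1 by left.
rewrite /right_RL_derivative.
have -> : (fun z => \int[mu]_(y in `]z, +oo[) (phi y / (y - z) `^ a)) =
    frac_integral a 1 phi.
  apply/funext => z; rewrite -(frac_integral_halfline a1 s1 tphi).
  rewrite (_ : [set y | _] = `]z, +oo[%classic).
    by apply: eq_Rintegral => y _; rewrite mul1r.
  by apply/seteqP; split => y /=; rewrite mul1r subr_gt0 in_itv/= andbT.
by rewrite (derive1_frac_integralE a0 a1 s1 tphi) mulr1 mulrA mulrNN.
Qed.

(** With s = -1 the factor - a s equals a, so the constant is the same as for the right
    derivative. *)
Lemma left_RL_derivativeE (phi : R -> R) x : test_function phi ->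
  left_RL_derivative a phi x =
  (Gamma (1 - a))^-1 * a * marchaud_derivative a (-1) phi x.
Proof.
move=> tphi; have s1 : (-1 : R) = 1 \/ (-1 : R) = -1 by right.
rewrite /left_RL_derivative.
have -> : (fun z => \int[mu]_(y in `]-oo, z[) (phi y / (z - y) `^ a)) =
    frac_integral a (-1) phi.
  apply/funext => z; rewrite -(frac_integral_halfline a1 s1 tphi).
  rewrite (_ : [set y | _] = `]-oo, z[%classic).
    by apply: eq_Rintegral => y _; rewrite mulN1r opprB.
  by apply/seteqP; split => y /=; rewrite mulN1r opprB subr_gt0 in_itv.
by rewrite (derive1_frac_integralE a0 a1 s1 tphi) mulrN1 opprK mulrA.
Qed.

Lemma L1_marchaud_differenceZ (s c : R) (u : R -> R) :
  s = 1 \/ s = -1 -> gagliardo_W1 a u ->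
  L1 (fun x => c * marchaud_difference a s u x).
Proof.
move=> s1 gu.
exact: (integrableZl measurableT c
  (integrable_marchaud_difference_integral s1 gu)).
Qed.

Lemma L1_locally_integrable (v : R -> R) :
  L1 v -> locally_integrable [set: R] v.
Proof. by move=> intv; apply: open_integrable_locally => //; exact: openT. Qed.

End Riemann_Liouville.

Theorem theorem4p39 (R : realType) (alpha : R) (alpha_gt0 : 0 < alpha)
    (alpha_lt1 : alpha < 1) :
  gagliardo_W1 alpha `<=` left_W1 alpha /\
  gagliardo_W1 alpha `<=` right_W1 alpha.
Proof.
split=> u gu; have [intu _] := gu; split=> //.
(* The left weak derivative is tested against right derivatives, hence s = 1; the witness, read off
   from [L1v], is a / Gamma(1 - a) times the integral of k(t) (u(x) - u(x - t)) over t. *)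
- have s1 : (1 : R) = 1 \/ (1 : R) = -1 by left.
  have L1v := L1_marchaud_differenceZ ((Gamma (1 - alpha))^-1 * alpha) s1 gu.
  eexists; split; last exact: L1v.
  split=> //; first exact: L1_locally_integrable.
  move=> phi tphi.
  rewrite (integral_marchaud_differenceZ alpha_gt0 alpha_lt1 s1 gu tphi).
  by apply: eq_integral => x _; rewrite right_RL_derivativeE.
(* Symmetrically s = -1, and the witness is built from u(x) - u(x + t). *)
- have s1 : (-1 : R) = 1 \/ (-1 : R) = -1 by right.
  have L1v := L1_marchaud_differenceZ ((Gamma (1 - alpha))^-1 * alpha) s1 gu.
  eexists; split; last exact: L1v.
  split=> //; first exact: L1_locally_integrable.
  move=> phi tphi.
  rewrite (integral_marchaud_differenceZ alpha_gt0 alpha_lt1 s1 gu tphi).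
  by apply: eq_integral => x _; rewrite left_RL_derivativeE.
Qed.
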